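(* Let $k\ge 2$ and let $R_k$ be the tree obtained from the star $K_{1,k-1}$ and the path $P_{2^{k-2}+1}$ (on $2^{k-2}+1$ vertices) by identifying a leaf of $K_{1,k-1}$ with an end vertex of $P_{2^{k-2}+1}$. Then $R_k$ is $k$-$cfc$-critical.
   Context: For an edge-colored graph, a path is conflict-free if some color occurs on exactly one of its edges; $cfc(G)$ is the minimum number of colors in an edge-coloring of the connected graph $G$ in which every pair of distinct vertices is joined by a conflict-free path. A nontrivial tree $T$ is $cfc$-critical if for every edge $e$ of $T$, every nontrivial component $T'$ of $T-e$ satisfies $cfc(T')<cfc(T)$; it is $k$-$cfc$-critical if in addition $cfc(T)=k$. *)

(* Defs.v *)
From mathcomp Require Import all_boot.
From mathcomp Require Import boolp.

Set Implicit Arguments.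
Unset Strict Implicit.
Unset Printing Implicit Defensive.

Record sgraph := SGraph {
  vertex :> finType;
  adj : rel vertex;
  adj_sym : symmetric adj;
  adj_irrefl : irreflexive adj
}.

Section Graphs.
Variable G : sgraph.

Definition edges : {set {set G}} :=
  [set e | [exists x, exists y, adj x y && (e == [set x; y])]].

Definition leaf (x : G) : bool := #|[set y | adj x y]| == 1.

Definition connected : Prop := forall x y : G, connect (@adj G) x y.

Definition acyclic : Prop :=
  forall s : seq G, ucycle (@adj G) s -> size s < 3.

Definition nontrivial : Prop := 1 < #|G|.

Definition tree : Prop := [/\ 0 < #|G|, connected & acyclic].

Definition component (x : G) : {set G} := [set y | connect (@adj G) x y].

Definition components : {set {set G}} := [set component x | x : G].

Definition del_adj (e : {set G}) : rel G :=
  [rel x y | adj x y && ([set x; y] != e)].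

Lemma del_adj_sym e : symmetric (del_adj e).
Proof. by move=> x y; rewrite /del_adj /= adj_sym setUC. Qed.

Lemma del_adj_irrefl e : irreflexive (del_adj e).
Proof. by move=> x; rewrite /del_adj /= adj_irrefl. Qed.

Definition del_edge (e : {set G}) : sgraph :=
  SGraph (del_adj_sym e) (del_adj_irrefl e).

Definition ind_adj (S : {set G}) : rel {x : G | x \in S} :=
  [rel x y | adj (val x) (val y)].

Lemma ind_adj_sym S : symmetric (@ind_adj S).
Proof. by move=> x y; rewrite /ind_adj /= adj_sym. Qed.

Lemma ind_adj_irrefl S : irreflexive (@ind_adj S).
Proof. by move=> x; rewrite /ind_adj /= adj_irrefl. Qed.

Definition induced (S : {set G}) : sgraph :=
  SGraph (@ind_adj_sym S) (@ind_adj_irrefl S).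

(* Edge sequence of the walk [x :: p]. *)
Definition path_edges (x : G) (p : seq G) : seq {set G} :=
  pairmap (fun a b => [set a; b]) x p.

Definition conflict_free (c : {set G} -> nat) (x : G) (p : seq G) : Prop :=
  exists a : nat, count_mem a (map c (path_edges x p)) = 1.

Definition cf_connected (c : {set G} -> nat) : Prop :=
  forall x y : G, x != y ->
    exists p : seq G,
      [/\ path (@adj G) x p, uniq (x :: p), last x p = y &
          conflict_free c x p].

(* Only the values of [c] on [edges] matter; the colors are 0, ..., n - 1. *)
Definition cf_colorable (n : nat) : Prop :=
  exists c : {set G} -> nat,
    (forall e, e \in edges -> c e < n) /\ cf_connected c.

(* The default 0 is only taken by disconnected graphs, see
   [connected_cf_colorable]. *)
Definition cfc : nat :=
  if pselect (exists n, `[< cf_colorable n >]) is left h then ex_minn h else 0.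

Lemma path_edges_sub (x : G) (p : seq G) (z : G) (e : {set G}) :
  e \in path_edges x p -> z \in e -> z \in x :: p.
Proof.
elim: p x => //= y p IH x; rewrite inE => /orP[/eqP->|ep] ze.
  by move: ze; rewrite !inE => /orP[] ->; rewrite ?orbT.
by rewrite inE (IH y) ?orbT.
Qed.

Lemma connected_cf_colorable : connected -> exists n, cf_colorable n.
Proof.
move=> cG; exists #|{set G}|, (fun e => enum_rank e : nat).
split=> [e _|x y xy]; first exact: ltn_ord.
case/connectP: (cG x y) xy => p0 /shortenP[p pp up _] -> xp.
exists p; split=> //.
case: p xp up {pp} => [|z p] /=; first by rewrite eqxx.
move=> _ /andP[xzp _]; exists (enum_rank [set x; z]); rewrite /= eqxx.
suff -> : count_mem (enum_rank [set x; z] : nat)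
    [seq (enum_rank e : nat) | e <- path_edges z p] = 0 by [].
apply/count_memPn/mapP => -[e ep /val_inj /enum_rank_inj eE].
have := path_edges_sub ep; rewrite -eE => /(_ x).
by rewrite !inE eqxx => /(_ isT); rewrite -in_cons (negPf xzp).
Qed.

End Graphs.

Definition cfc_critical (T : sgraph) : Prop :=
  [/\ tree T, nontrivial T &
      forall e, e \in edges T ->
        forall S, S \in components (del_edge e) ->
          nontrivial (induced S) -> cfc (induced S) < cfc T].

Definition k_cfc_critical (k : nat) (T : sgraph) : Prop :=
  cfc_critical T /\ cfc T = k.

(* The star K_{1,m}; its center is [ord0]. *)
Definition star_adj m : rel 'I_m.+1 :=
  [rel x y | (x == ord0) (+) (y == ord0)].

Lemma star_adj_sym m : symmetric (@star_adj m).
Proof. by move=> x y; rewrite /star_adj /= addbC. Qed.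

Lemma star_adj_irrefl m : irreflexive (@star_adj m).
Proof. by move=> x; rewrite /star_adj /= addbb. Qed.

Definition star m : sgraph := SGraph (@star_adj_sym m) (@star_adj_irrefl m).

Definition path_adj n : rel 'I_n :=
  [rel x y : 'I_n | (x.+1 == y :> nat) || (y.+1 == x :> nat)].

Lemma path_adj_sym n : symmetric (@path_adj n).
Proof. by move=> x y; rewrite /path_adj /= orbC. Qed.

Lemma path_adj_irrefl n : irreflexive (@path_adj n).
Proof. by move=> x; rewrite /path_adj /= orbb eqn_leq ltnn. Qed.

(* The path on n vertices. *)
Definition path_graph n : sgraph :=
  SGraph (@path_adj_sym n) (@path_adj_irrefl n).

Section Identify.
Variables (G H : sgraph) (u : G) (v : H).

(* Disjoint union of G and H with v identified with u: the vertex v of H is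
   dropped and its role is played by [inl u]. *)
Definition identify_adj : rel (G + {y : H | y != v}) :=
  fun a b => match a, b with
  | inl x, inl x' => adj x x'
  | inr y, inr y' => adj (val y) (val y')
  | inl x, inr y | inr y, inl x => (x == u) && adj v (val y)
  end.

Lemma identify_adj_sym : symmetric identify_adj.
Proof. by move=> [x|y] [x'|y'] //=; rewrite adj_sym. Qed.

Lemma identify_adj_irrefl : irreflexive identify_adj.
Proof. by move=> [x|y] /=; rewrite adj_irrefl. Qed.

Definition identify : sgraph := SGraph identify_adj_sym identify_adj_irrefl.

End Identify.

(* Main.v *)
(* Place the vertices of R_k, k = m + 2, at heights: the center of the star at 1,
   the leaf l at 2, the path above it up to 2^m + 2, and the m other leaves of
   the star at 0; adjacency means that the heights differ by one.

   Lower bound: with m + 1 colors, the edges at the center use every color once.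
   Let w be the color word of the path from the center to the top, f its first
   letter; all factors of w, and i w' for i <> f and every prefix w' of w, are
   conflict-free.  If f does not recur in w, the rest of w uses m colors and has
   length < 2^m.  Otherwise w has a unique letter a <> f, and since a w is
   conflict-free there is another unique letter b <> a, f; if b comes after a,
   the part of w before b misses b and is bounded by induction, the part after b
   misses a and b.  So |w| <= 2^m, while w has 2^m + 1 letters.

   Upper bounds: color the path above l with the 2-adic valuations of
   1, ..., 2^m, in which every interval has a unique maximum.  If the edge from
   the center to l gets a new color m + 1, everything is conflict-free.  If it
   gets the color m instead, the only repeated use of m is at the top of the
   path, and the only words without a unique letter run from a leaf colored
   m - 1 (or from the center, when m = 0) to the top.  Choosing that leaf
   appropriately, these paths are destroyed by the deletion of any given edge. *)
Require Import Defs.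
From mathcomp Require Import all_boot.
From mathcomp Require Import boolp zify.

Set Implicit Arguments.
Unset Strict Implicit.
Unset Printing Implicit Defensive.

(** * Conflict-free words *)

Section Words.
Variable T : eqType.
Implicit Types (w u t C : seq T) (a b f : T).

Definition cf_word w := exists a, count_mem a w = 1.

Definition cf_factors w :=
  forall u v t, w = u ++ v ++ t -> 0 < size v -> cf_word v.

Lemma cf_word_split w a : count_mem a w = 1 ->
  exists u t, [/\ w = u ++ a :: t, a \notin u & a \notin t].
Proof.
move=> wa; have aw : a \in w by rewrite -has_pred1 has_count wa.
case/splitPr: aw wa => u t; rewrite count_cat /= eqxx => wa.
by exists u, t; split=> //; apply/count_memPn; lia.
Qed.

Lemma sub_rem C w a :
  {subset w <= C} -> a \notin w -> {subset w <= rem a C}.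
Proof.
move=> wC aw x xw; have xC := wC _ xw.
have xa : x != a by apply: contraNneq aw => <-.
case aC: (a \in C); last by rewrite rem_id ?aC.
by move: xC; rewrite (perm_mem (perm_to_rem aC)) inE (negPf xa).
Qed.

Lemma cf_factorsL u t : cf_factors (u ++ t) -> cf_factors u.
Proof.
by move=> H p v s E; apply: (H p v (s ++ t)); rewrite E -!catA.
Qed.

Lemma cf_factorsR u t : cf_factors (u ++ t) -> cf_factors t.
Proof. by move=> H p v s E; apply: (H (u ++ p) v s); rewrite E -!catA. Qed.

(** A letter that is unique in [w] splits it into two factors over an alphabet with one letter less,
    and 2 * (2^(c-1) - 1) + 1 = 2^c - 1. *)
Lemma cf_factors_size C w :
  {subset w <= C} -> cf_factors w -> size w < 2 ^ size C.
Proof.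
have [n] := ubnP (size C); elim: n C w => // n IH C w sC wC cw.
case: (posnP (size w)) => [->|w0]; first by rewrite expn_gt0.
have [a] : cf_word w by apply: (cw [::] w [::]); rewrite ?cats0.
case/cf_word_split=> u [t [E au at_]]; subst w.
have aC : a \in C by apply: wC; rewrite mem_cat inE eqxx orbT.
have sr := size_rem aC; have C0 : 0 < size C by case: (C) aC.
have uC : {subset u <= rem a C}.
  by apply: sub_rem au => x xu; apply: wC; rewrite mem_cat xu.
have tC : {subset t <= rem a C}.
  by apply: sub_rem at_ => x xt; apply: wC; rewrite mem_cat inE xt !orbT.
have Hu := IH _ _ _ uC (cf_factorsL cw).
have Ht : size t < 2 ^ size (rem a C).
  apply: IH tC _; first by lia.
  by move: cw; rewrite -cat1s => /cf_factorsR /cf_factorsR.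
have : size u < 2 ^ size (rem a C) by apply: Hu; lia.
rewrite size_cat /= sr in Ht *; case: (size C) C0 Ht => //= c _; rewrite expnS; lia.
Qed.

(* The bound [2 ^ (size C).-1] is half of that of [cf_factors_size]: the words
   [i :: f :: u] are those read along the path from the other edges at its
   starting vertex. *)
Lemma cf_pendant_size C f w : f \in C -> {subset w <= C} ->
    cf_factors (f :: w) ->
    (forall i u t, i \in C -> i != f -> w = u ++ t -> cf_word [:: i, f & u]) ->
  (size w).+1 <= 2 ^ (size C).-1.
Proof.
have [n] := ubnP (size C); elim: n C w => // n IH C w sC fC wC cw pw.
have C0 : 0 < size C by case: (C) fC.
case fw: (f \in w); last first.
  have := @cf_factors_size (rem f C) w; rewrite size_rem //; apply.
    by apply: sub_rem => //; rewrite fw.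
  by move: cw; rewrite -cat1s => /cf_factorsR.
(* Let c be the size of [C]. The part before [b] misses [b] and falls under the induction
   hypothesis; the part after [b] misses both [a] and [b]. Each contributes at most 2^(c-2) to the
   bound. *)
have key a b : a != b -> count_mem a w = 1 -> count_mem b w = 1 ->
    a != f -> b != f -> index a w < index b w ->
    (size w).+1 <= 2 ^ (size C).-1.
  move=> ab wa wb af bf; have [u [t [E bu bt]]] := cf_word_split wb.
  subst w => iab.
  have au : a \in u.
    apply/negPn/negP => au; move: iab.
    by rewrite !index_cat (negPf au) (negPf bu) /= eqxx; clear; lia.
  have at_ : a \notin t.
    apply/count_memPn; move: wa; rewrite count_cat /=.
    have : 0 < count_mem a u by rewrite -has_count has_pred1.
    clear; lia.
  have bC : b \in C by apply: wC; rewrite mem_cat inE eqxx orbT.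
  have aC : a \in C by apply: wC; rewrite mem_cat au.
  have uC : {subset u <= rem b C}.
    by apply: sub_rem bu => x xu; apply: wC; rewrite mem_cat xu.
  have tC : {subset t <= rem a (rem b C)}.
    apply: sub_rem at_; apply: sub_rem bt => x xt.
    by apply: wC; rewrite mem_cat inE xt !orbT.
  have rC x : x \in C -> x != b -> x \in rem b C.
    by move=> xC xb; move: xC; rewrite (perm_mem (perm_to_rem bC)) inE (negPf xb).
  have sb := size_rem bC; have sa := size_rem (rC _ aC ab).
  have s0 : 0 < size (rem b C) by case: (rem b C) (rC _ aC ab).
  have Hu : (size u).+1 <= 2 ^ (size (rem b C)).-1.
    apply: IH => //; first by clear -sb sC s0; lia.
    - by apply: rC => //; rewrite eq_sym.
    - exact: (@cf_factorsL (f :: u) (b :: t)).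
    - move=> i p s iC jf E; apply: (pw i p (s ++ b :: t)) => //.
        exact: mem_rem iC.
      by rewrite E -catA.
  have Ht : size t < 2 ^ size (rem a (rem b C)).
    apply: cf_factors_size tC _; apply: (@cf_factorsR (f :: u ++ [:: b])).
    by rewrite /= -catA.
  rewrite size_cat /=; rewrite sa sb in Hu Ht s0 *.
  clear -Hu Ht s0; case: (size C) Hu Ht s0 => [|[|c]] //=; rewrite expnS; lia.
have cfw : 0 < count_mem f w by rewrite -has_count has_pred1.
(* Since [f] recurs in [w], the unique letter of [f :: w] is another one, and it is unique in [w] as
   well. *)
have [a wa] : cf_word (f :: w) by apply: (cw [::] _ [::]); rewrite ?cats0.
have af : a != f by apply/eqP => E; move: wa; rewrite E /= eqxx; lia.
have wa1 : count_mem a w = 1 by move: wa; rewrite /= eq_sym (negPf af).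
have aw : a \in w by rewrite -has_pred1 has_count wa1.
(* Prefixing [a] doubles it, which forces a second unique letter [b]. *)
have [b] := pw a w [::] (wC _ aw) af (esym (cats0 w)).
rewrite /= => wb.
have ab : a != b.
  by apply/eqP => E; move: wb wa1; rewrite -E eqxx; lia.
have bf : b != f by apply/eqP => E; move: wb; rewrite E eqxx; lia.
have wb1 : count_mem b w = 1.
  by move: wb; rewrite (negPf ab) eq_sym (negPf bf).
have bw : b \in w by rewrite -has_pred1 has_count wb1.
case: (ltngtP (index a w) (index b w)) => [|lt|E].
- exact: key.
- by apply: (key b a) => //; rewrite eq_sym.
- by move: ab; rewrite -(nth_index a aw) E nth_index ?eqxx.
Qed.

Lemma count_map_inj (U : eqType) (F : U -> T) (s : seq U) z :
  uniq s -> z \in s -> {in s, forall y, F y = F z -> y = z} ->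
  count_mem (F z) (map F s) = 1.
Proof.
move=> us zs inj; transitivity (count_mem z s); last by rewrite count_uniq_mem // zs.
by rewrite count_map; apply: eq_in_count => y ys /=; apply/eqP/eqP => [/inj->//|->].
Qed.

End Words.

(** The largest valuation d on the interval is attained only once: between two odd multiples of 2^d
    lies an even one, of larger valuation. *)
Lemma ruler a b : 0 < a -> a < b ->
  exists2 i, a <= i < b &
    forall j, a <= j < b -> logn 2 j = logn 2 i -> j = i.
Proof.
move=> a0 ab.
have ex : exists d, has (fun j => logn 2 j == d) (iota a (b - a)).
  by exists (logn 2 a); apply/hasP; exists a; rewrite ?mem_iota; lia.
have bd d : has (fun j => logn 2 j == d) (iota a (b - a)) -> d <= b.
  case/hasP=> j; rewrite mem_iota => ji /eqP<-.
  have j0 : 0 < j by lia.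
  have := dvdn_leq j0 (pfactor_dvdnn 2 j); have := ltn_expl (logn 2 j) (isT : 1 < 2).
  lia.
case: (ex_maxnP ex bd) => d /hasP[i]; rewrite mem_iota => ii /eqP di dmax.
have noc i1 i2 : a <= i1 -> i2 < b -> i1 < i2 -> logn 2 i1 = d -> logn 2 i2 = d ->
    False.
  move=> ai1 i2b i12 d1 d2.
  have e1 : 2 ^ d %| i1 by rewrite -d1 pfactor_dvdnn.
  have e2 : 2 ^ d %| i2 by rewrite -d2 pfactor_dvdnn.
  have n1 : ~~ (2 ^ d.+1 %| i1) by rewrite pfactor_dvdn //; lia.
  have [t1 E1] := dvdnP e1; have [t2 E2] := dvdnP e2.
  have o1 : odd t1.
    apply: contraR n1 => /negPf ev; rewrite E1 expnS.
    by apply: dvdn_mul => //; rewrite dvdn2 ev.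
  have D0 : 0 < 2 ^ d by rewrite expn_gt0.
  have t12 : t1 < t2 by rewrite -(ltn_pmul2r D0) -E1 -E2.
  have le : (t1.+1) * 2 ^ d <= i2 by rewrite E2 leq_mul2r t12 orbT.
  have dv : 2 ^ d.+1 %| t1.+1 * 2 ^ d.
    by rewrite expnS; apply: dvdn_mul => //; rewrite dvdn2 /= o1.
  have g : i1 < t1.+1 * 2 ^ d by rewrite E1 ltn_pmul2r.
  have := dmax (logn 2 (t1.+1 * 2 ^ d)).
  rewrite pfactor_dvdn // in dv; last by lia.
  suff -> : has (fun j => logn 2 j == logn 2 (t1.+1 * 2 ^ d)) (iota a (b - a)).
    by move=> /(_ isT); lia.
  by apply/hasP; exists (t1.+1 * 2 ^ d); rewrite ?mem_iota //; lia.
exists i; first by lia.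
move=> j jab E; case: (ltngtP i j) => // lt; exfalso.
- by apply: (noc i j) => //; lia.
- by apply: (noc j i) => //; lia.
Qed.

Lemma logn2_lt m i : 0 < i < 2 ^ m -> logn 2 i < m.
Proof.
move=> /andP[i0 im]; rewrite ltnNge; apply/negP => le.
by have := dvdn_leq i0 (dvdn_trans (dvdn_exp2l 2 le) (pfactor_dvdnn 2 i)); lia.
Qed.

(** The positive multiples of 2^m in this range are 2^m and 2^(m+1), and the latter has valuation m
    + 1. *)
Lemma logn2_max m i : 0 < i <= 2 ^ m.+1 -> logn 2 i = m -> i = 2 ^ m.
Proof.
move=> /andP[i0 im] E; have := pfactor_dvdnn 2 i; rewrite E => /dvdnP[t Et].
have t2 : t <= 2.
  by move: im; rewrite Et expnS leq_mul2r; have := expn_gt0 2 m; case: (2 ^ m).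
case: t t2 Et => [|[|[|]]] // _ Et; first by lia.
  by rewrite Et mul1n.
by move: E; rewrite Et -expnS pfactorK //; lia.
Qed.

(** * Conflict-free paths in graphs *)

Section Linked.
Variables (V : finType) (r : rel V) (c : {set V} -> nat).

(* [path_edges], but not tied to a graph, so that the same sequence serves [G]
   and [del_edge e]. *)
Definition edge_seq (x : V) (p : seq V) := pairmap (fun a b => [set a; b]) x p.

Definition cf_linked (x y : V) :=
  exists p, [/\ path r x p, uniq (x :: p), last x p = y &
                cf_word (map c (edge_seq x p))].

Lemma edge_seq_rev x p :
  edge_seq (last x p) (rev (belast x p)) = rev (edge_seq x p).
Proof.
elim: p x => //= y p IH x; rewrite rev_cons -cats1 /edge_seq pairmap_cat.
rewrite -/(edge_seq _ _) IH /= rev_cons -cats1; congr (_ ++ [:: _]).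
suff -> : last (last y p) (rev (belast y p)) = y by rewrite setUC.
by case: (p) => //= z q; rewrite rev_cons last_rcons.
Qed.

Lemma cf_linked_sym x y : symmetric r -> cf_linked x y -> cf_linked y x.
Proof.
move=> rs [p [pp up <- [a ca]]]; exists (rev (belast x p)); split.
- by rewrite -rev_path in pp; move: pp; under eq_path do rewrite /= rs.
- by rewrite -rev_rcons -lastI rev_uniq.
- by case: (p) => //= z q; rewrite rev_cons last_rcons.
- by exists a; rewrite edge_seq_rev map_rev count_rev.
Qed.

(** With colors attached to the lower ends of edges, the color word of a rising path is read off its
    vertices, the last one excluded. *)
Lemma colors_belast (f : V -> nat) (rise : rel V) x p :
  (forall u w, rise u w -> c [set u; w] = f u) -> path rise x p ->
  map c (edge_seq x p) = map f (belast x p).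
Proof.
move=> H; elim: p x => //= y p IH x /andP[xy pp].
by rewrite H // -/(edge_seq y p) IH.
Qed.

(** Heights orient the edges, so the lower end can be recovered from the unordered pair. Sets
    containing no such pair get the default color 0. *)
Lemma exists_edge_coloring (h f : V -> nat) :
  exists d : {set V} -> nat,
    forall x y, (h x).+1 == h y -> d [set x; y] = f x.
Proof.
exists (fun e : {set V} => oapp f 0 [pick x in e | [exists y in e, (h x).+1 == h y]]).
move=> x y /eqP xy; case: pickP => [z /andP[]|/(_ x)].
  rewrite !inE => /orP[]/eqP-> // /existsP[w /andP[]].
  by rewrite !inE => /orP[]/eqP-> /eqP; lia.
rewrite !inE eqxx /= => /existsP[]; exists y.
by rewrite !inE eqxx orbT xy eqxx.
Qed.

(** Numbers [P] so that a prescribed element comes last; this is how the leaf of color [m.-1] will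
    be chosen. *)
Lemma exists_indexing (P : {set V}) (a : V) :
  exists idx : V -> nat,
    [/\ {in P &, injective idx}, {in P, forall x, idx x < #|P|} &
        {in P, forall x, a \in P -> idx x = #|P|.-1 -> x = a}].
Proof.
pose s := enum (P :\ a).
have ms x : x \in P -> x != a -> x \in s by move=> xP xa; rewrite mem_enum !inE xa.
have ss : size s + (a \in P) = #|P| by rewrite -cardE [#|P|](cardsD1 a) addnC.
have ix x : x \in P -> x != a -> index x s + (a \in P) < #|P|.
  by move=> xP xa; rewrite -ss ltn_add2r index_mem ms.
exists (fun x => if x == a then #|P|.-1 else index x s); split=> [x y xP yP|x xP|x xP aP].
- case: (eqVneq x a) => [xa|xa]; case: (eqVneq y a) => [ya|ya] E.
  + by rewrite xa ya.
  + by have := ix y yP ya; rewrite -E -xa xP; lia.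
  + by have := ix x xP xa; rewrite E -ya yP; lia.
  + by rewrite -(nth_index x (ms x xP xa)) E nth_index ?ms.
- case: (eqVneq x a) => [_|xa]; last by have := ix x xP xa; lia.
  have : 0 < #|P| by apply/card_gt0P; exists x.
  by lia.
- case: (eqVneq x a) => // xa E; have := ix x xP xa; rewrite E aP; lia.
Qed.

End Linked.

Lemma cf_connected_connected (G : sgraph) (c : {set G} -> nat) :
  cf_connected c -> connected G.
Proof.
move=> H x y; case: (eqVneq x y) => [->|/H[p [pp _ E _]]]; first exact: connect0.
by apply/connectP; exists p.
Qed.

Lemma cf_colorable_leq (G : sgraph) m n :
  m <= n -> cf_colorable G m -> cf_colorable G n.
Proof.
by move=> mn [c [cm H]]; exists c; split=> // e /cm; lia.
Qed.

Lemma cfc_leq (G : sgraph) n : cf_colorable G n -> cfc G <= n.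
Proof.
move=> H; rewrite /cfc; case: pselect => // h.
by case: ex_minnP => m _; apply; apply/asboolP.
Qed.

Lemma cfc_eq (G : sgraph) n :
  cf_colorable G n.+1 -> ~ cf_colorable G n -> cfc G = n.+1.
Proof.
move=> H1 H0; apply/eqP; rewrite eqn_leq cfc_leq //= /cfc.
case: pselect => [h|[]]; last by exists n.+1; apply/asboolP.
case: ex_minnP => m /asboolP Hm _; rewrite ltnNge; apply/negP => mn.
exact/H0/cf_colorable_leq/Hm.
Qed.

(** Linking can be checked in [G] itself, because a path that starts in a component never leaves
    it. *)
Lemma cf_colorable_component (G : sgraph) (z : G) (c : {set G} -> nat) n :
  (forall e, e \in edges G -> c e < n) ->
  {in component z &, forall x y, x != y -> cf_linked (@adj G) c x y} ->
  cf_colorable (induced (component z)) n.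
Proof.
move=> cn H; pose S := component z.
exists (fun e : {set induced S} => c (val @: e)); split=> [e|x y xy].
  rewrite inE => /existsP[x /existsP[y /andP[xy /eqP->]]].
  apply: cn; rewrite inE imsetU !imset_set1.
  by apply/existsP; exists (val x); apply/existsP; exists (val y); rewrite eqxx andbT.
have [p [pp up pl pc]] := H _ _ (valP x) (valP y) xy.
(* The path stays in [S], so it lifts to the subtype. *)
have [q Eq] : exists q : seq (induced S), map val q = p.
  have : {subset p <= S}.
    move=> w wp; have := valP x; rewrite !inE => zx.
    by apply: connect_trans zx (path_connect pp _); rewrite inE wp orbT.
  elim: (p) => [|w q IH] sub; first by exists [::].
  have [q' <-] := IH (fun u uq => sub u (mem_behead (s := w :: q) uq)).
  have wS : w \in S by apply: sub; rewrite inE eqxx.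
  by exists (exist _ w wS :: q').
subst p; exists q; split.
- by move: pp; rewrite path_map.
- by move: up; rewrite -map_cons map_inj_uniq //; exact: val_inj.
- by apply: val_inj; rewrite -last_map.
- suff E : map (fun e : {set induced S} => c (val @: e)) (path_edges x q) = map c (edge_seq (val x) (map val q)).
    by rewrite /conflict_free E.
  by elim: (q) (x) => //= w s IH u; rewrite IH imsetU !imset_set1.
Qed.

(** * Brooms *)

(* [h] is the height; [v j] is the only vertex of height [j] for [0 < j <= M],
   whereas any number of vertices may have height 0. *)
Record broom (G : sgraph) (M : nat) (h : G -> nat) (v : nat -> G) : Prop := Broom {
  broom_adj : forall x y, adj x y = ((h x).+1 == h y) || ((h y).+1 == h x);
  broom_inj : forall x y, 0 < h x -> h x = h y -> x = y;
  broom_le : forall x, h x <= M;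
  broom_vK : forall j, 0 < j <= M -> h (v j) = j
}.

Section Broom.
Variables (G : sgraph) (M : nat) (h : G -> nat) (v : nat -> G).
Hypothesis B : broom M h v.

Let adjE := broom_adj B.
Let h_inj := broom_inj B.
Let h_le := broom_le B.
Let vK := broom_vK B.

Lemma broom_hK x : 0 < h x -> v (h x) = x.
Proof. by move=> x0; apply/esym/h_inj; rewrite ?vK // x0 h_le. Qed.

Lemma path_map_iota (r : rel G) i n :
  (forall j, i <= j < i + n -> r (v j) (v j.+1)) ->
  path r (v i) (map v (iota i.+1 n)).
Proof.
elim: n i => //= n IH i H; rewrite H ?IH //; last by lia.
by move=> j ji; apply: H; lia.
Qed.

(** These are the lower ends of the edges on the rising path. [x] is listed separately because at
    height 0 it need not be [v (h x)]. *)
Definition lower_part x y := x :: map v (iota (h x).+1 (h y - h x).-1).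

Definition rising_path x y := map v (iota (h x).+1 (h y - h x)).

Lemma last_rising_path x y : h x < h y -> last x (rising_path x y) = y.
Proof.
move=> xy; rewrite -nth_last size_map size_iota (nth_map 0) ?size_iota; last by lia.
by rewrite nth_iota; [rewrite -[RHS]broom_hK; [congr v|]|]; lia.
Qed.

Lemma belast_rising_path x y :
  h x < h y -> belast x (rising_path x y) = lower_part x y.
Proof.
move=> xy; rewrite /rising_path /lower_part.
have -> : h y - h x = (h y - h x).-1.+1 by lia.
move: (_.-1) => n; rewrite /=; elim: n x {xy} (h x) => //= n IH x i.
by rewrite IH.
Qed.

Lemma mem_lower_part x y u : h x < h y ->
  u \in lower_part x y -> (h x <= h u < h y) && ((u == x) || (h x < h u)).
Proof.
move=> xy; rewrite inE => /orP[/eqP->|/mapP[j]]; first by rewrite eqxx; lia.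
rewrite mem_iota => ji ->; have := h_le y => yM.
by rewrite vK; lia.
Qed.

Lemma lower_part_height x y j : h x <= j < h y ->
  exists2 u, u \in lower_part x y & h u = j.
Proof.
move=> ji; case: (eqVneq j (h x)) => [->|jx]; first by exists x; rewrite ?inE ?eqxx.
have := h_le y => yM; exists (v j); last by rewrite vK //; lia.
by rewrite inE map_f ?orbT // mem_iota; lia.
Qed.

Lemma uniq_rising_path x y : h x < h y -> uniq (x :: rising_path x y).
Proof.
move=> xy; apply: (@map_uniq _ _ h); rewrite /= -map_comp.
rewrite (@eq_in_map _ _ _ id _).1 ?map_id; first by rewrite mem_iota iota_uniq; lia.
by move=> j; rewrite mem_iota /= => ji; have := h_le y => yM; rewrite vK; lia.
Qed.

Lemma path_rising_path (r : rel G) x y : h x < h y ->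
  {in lower_part x y, forall u w, (h u).+1 == h w -> r u w} ->
  path r x (rising_path x y).
Proof.
move=> xy H; have := h_le y => yM; rewrite /rising_path.
have -> : h y - h x = (h y - h x).-1.+1 by lia.
rewrite /= H ?inE ?eqxx //; last by rewrite vK; lia.
apply: path_map_iota => j ji; apply: H; last by rewrite !vK; lia.
by rewrite inE map_f ?orbT // mem_iota; lia.
Qed.

Lemma cf_linked_rising (r : rel G) (c : {set G} -> nat) (f : G -> nat) x y :
  h x < h y -> {in lower_part x y, forall u w, (h u).+1 == h w -> r u w} ->
  (forall u w, (h u).+1 == h w -> c [set u; w] = f u) ->
  cf_word (map f (lower_part x y)) -> cf_linked r c x y.
Proof.
move=> xy H cf cw; exists (rising_path x y); split.
- exact: path_rising_path.
- exact: uniq_rising_path.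
- exact: last_rising_path.
- rewrite (@colors_belast _ c f [rel u w | (h u).+1 == h w]) ?belast_rising_path //.
  exact: path_rising_path.
Qed.

Lemma cf_linked_pendant (r : rel G) (c : {set G} -> nat) (f : G -> nat) x y :
  0 < M -> h x = 0 -> h y = 0 -> x != y -> f x != f y -> r x (v 1) -> r (v 1) y ->
  (forall u w, (h u).+1 == h w -> c [set u; w] = f u) ->
  cf_linked r c x y.
Proof.
move=> M0 hx hy xy fxy rx ry cf; have v1 : h (v 1) = 1 by rewrite vK.
exists [:: v 1; y]; split=> //=; first by rewrite rx ry.
  have vn u : h u = 0 -> v 1 != u.
    by move=> u0; apply/eqP => E; move: v1; rewrite E u0.
  by rewrite !inE (negPf xy) orbF andbT eq_sym !vn.
exists (f x); rewrite /= [[set v 1; y]]setUC !cf ?hx ?hy ?v1 // eqxx.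
by rewrite eq_sym (negPf fxy).
Qed.

(** A first step down from [x] is impossible: by induction the rest would rise from there and meet
    [x] again, the only vertex of its positive height. *)
Lemma up_path_unique x p : path (@adj G) x p -> uniq (x :: p) ->
  h x < h (last x p) -> p = rising_path x (last x p).
Proof.
elim: p x => [|y p IH] x; first by rewrite /= ltnn.
rewrite [path _ _ _]/= adjE => /andP[xy pp] up /= xl.
have up' : uniq (y :: p) by case/andP: up.
case: (eqVneq (h x).+1 (h y)) xy => [xy _|_ /= /eqP yx].
  rewrite /rising_path -/(last y p).
  have -> : h (last y p) - h x = (h (last y p) - h x).-1.+1 by lia.
  rewrite /= xy broom_hK; last by lia.
  congr (_ :: _); case: (eqVneq (h y) (h (last y p))) => [E|ne].
    have -> : (h (last y p) - h x).-1 = 0 by lia.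
    have {}E : y = last y p by apply: h_inj; lia.
    by case: p {IH pp xl up} E up' => //= z p E; rewrite {1}E mem_last.
  have lt : h y < h (last y p) by lia.
  by rewrite {1}(IH y pp up' lt) /rising_path; congr (map _ (iota _ _)); lia.
have lt : h y < h (last y p) by lia.
have E := IH y pp up' lt.
move: up => /= /andP[]; rewrite inE negb_or => /andP[_].
case/negP; rewrite E -(broom_hK (x := x)) ?map_f //; last by lia.
by rewrite mem_iota; lia.
Qed.

(** The first step leads to height 1; the rest, reversed, rises from [y] to that vertex, so
    [up_path_unique] applies. *)
Lemma pendant_path_unique x y p : h x = 0 -> h y = 0 -> x != y ->
  path (@adj G) x p -> uniq (x :: p) -> last x p = y -> p = [:: v 1; y].
Proof.
move=> hx hy xy; case: p => [|z p] /=; first by move=> _ _ E; rewrite E eqxx in xy.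
rewrite adjE hx /= orbF => /andP[/eqP z1 pp] /andP[_ up] E.
have pr : path (@adj G) y (rev (belast z p)).
  rewrite -E rev_path -(eq_path (e := @adj G)) // => u w; exact: adj_sym.
have ur : uniq (y :: rev (belast z p)).
  by rewrite -E -rev_rcons -lastI rev_uniq.
have lr : last y (rev (belast z p)) = z.
  case: (p) E => [|w q] /=; last by rewrite rev_cons last_rcons.
  by move=> E; move: z1; rewrite E hy.
have := up_path_unique pr ur; rewrite lr hy -z1 => /(_ isT).
rewrite /rising_path hy -z1 /= => /(congr1 rev); rewrite revK.
by case: p E {pp up pr ur lr} => [|w [|a b]] //= -> [->].
Qed.

(** Both neighbors of a highest vertex [x] of a cycle lie one level lower. At positive height they
    coincide; at height 0 the vertex following [y] is [x] again. *)
Lemma broom_acyclic : acyclic G.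
Proof.
move=> s /andP[cs us]; rewrite ltnNge; apply/negP => s3.
have [x0 x0s] : exists x, x \in s by case: (s) s3 => // x q _; exists x; rewrite inE eqxx.
case: (@arg_maxnP _ x0 (mem s) h x0s) => x xs xmax.
have [i q E] := rot_to xs.
have uq : uniq (x :: q) by rewrite -E rot_uniq.
have cq : cycle (@adj G) (x :: q) by rewrite -E rot_cycle.
have sq : 2 < size (x :: q) by rewrite -E size_rot.
have mq u : u \in x :: q -> h u <= h x by rewrite -E mem_rot; apply: xmax.
have dn u w : adj u w -> h w <= h u -> h u = (h w).+1.
  by rewrite adjE => /orP[]/eqP; lia.
case: q {E} uq cq sq mq => [|y [|w q]] // uq cq _ mq.
move: cq; rewrite (cycle_path x) /= => /and4P[zx xy yw _].
set z := last w q in zx.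
have hy := dn _ _ xy (mq y ltac:(by rewrite !inE eqxx orbT)).
have zin : z \in w :: q by rewrite mem_last.
have hz : h x = (h z).+1.
  by apply: dn; [rewrite adj_sym|apply: mq; rewrite !inE -in_cons zin !orbT].
move: uq => /= /and3P[xn yn _].
case: (posnP (h y)) => [y0|y0]; last first.
  by move: yn; rewrite (h_inj y0 (y := z)) ?zin //; lia.
have wx : w = x.
  by move: yw; rewrite adjE => /orP[]/eqP ?; apply: h_inj; lia.
by move: xn; rewrite wx !inE eqxx orbT.
Qed.

End Broom.

(** * Criticality of the broom with m vertices at height 0 and top height 2^m + 2 *)

Section BroomCritical.
Variables (G : sgraph) (m : nat) (h : G -> nat) (v : nat -> G).
Let M := (2 ^ m).+2.
Hypothesis B : broom M h v.
Let P : {set G} := [set x | h x == 0].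
Hypothesis cardP : #|P| = m.

Let adjE := broom_adj B.
Let h_inj := broom_inj B.
Let h_le := broom_le B.
Let vK := broom_vK B.
Let M0 : 0 < M. Proof. by []. Qed.

(* The color of the edge going up from [x]; for [1 < h x] the subtraction of 1
   makes the edges above height 2 carry the valuations of 1, 2, 3, ... *)
Definition ruler_color (idx : G -> nat) c1 x :=
  if h x == 0 then idx x else if h x == 1 then c1 else logn 2 (h x).-1.

Lemma ruler_color_lt idx c1 x : {in P, forall x, idx x < m} -> m <= c1 ->
  h x < M -> ruler_color idx c1 x <= c1.
Proof.
move=> iP mc xM; rewrite /ruler_color; case: eqP => [x0|x0].
  by have := iP x; rewrite inE x0 => /(_ isT); lia.
case: eqP => // x1; apply: leq_trans mc; rewrite -ltnS; apply: logn2_lt.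
by rewrite expnS; have := expn_gt0 2 m; rewrite /M in xM; lia.
Qed.

(* When the color [c1] of the edge above height 1 is [m], it recurs at the top of
   the path; then the color [m.-1], at height [2 ^ m.-1 + 1], takes over. *)
Lemma ruler_word idx c1 x y : h x < h y ->
  {in P, forall x, idx x < m} -> m <= c1 ->
  [|| m < c1, 1 < h x, h y < M
    | (0 < m) && ((h x == 0) ==> (idx x != m.-1))] ->
  cf_word (map (ruler_color idx c1) (lower_part h v x y)).
Proof.
move=> xy iP mc H; set F := ruler_color _ _; set L := lower_part _ _ _ _.
have yM := h_le y.
have uL : uniq L.
  have := uniq_rising_path B xy.
  by rewrite lastI rcons_uniq (belast_rising_path v xy) => /andP[].
have hL u : u \in L -> h x <= h u < h y by case/(mem_lower_part B xy)/andP.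
have eL u z : u \in L -> z \in L -> h u = h z -> u = z.
  move=> uL' zL E; case: (posnP (h u)) => [u0|u0]; last exact: h_inj.
  have := mem_lower_part B xy uL'; have := mem_lower_part B xy zL.
  by rewrite -E u0 !ltn0 !orbF => /andP[_ /eqP->] /andP[_ /eqP->].
have F1 u : h u = 1 -> F u = c1 by rewrite /F /ruler_color => ->.
have F2 u : 1 < h u -> F u = logn 2 (h u).-1.
  by rewrite /F /ruler_color; case: (h u) => [|[]].
have F0 u : h u = 0 -> F u < m.
  by move=> u0; have := iP u; rewrite /F /ruler_color inE u0 => /(_ isT).
(* The path has one vertex per height, so a height whose color occurs at no other height is
   enough. *)
have unique j : h x <= j < h y ->
    (forall u z, u \in L -> z \in L -> h z = j -> F u = F z -> h u = j) ->
    cf_word (map F L).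
  move=> jxy Hj; have [z zL zj] := lower_part_height B jxy.
  exists (F z); apply: count_map_inj => // u uL' E; apply: eL => //.
  by rewrite zj; apply: (Hj u z).
case: (ltnP 1 (h x)) H => [x1 _|x1].
  have a0 : 0 < (h x).-1 by lia.
  have [|i ii Hi] := @ruler _ (h y).-1 a0; first by lia.
  apply: (unique i.+1); first by lia.
  move=> u z /hL uL' /hL zL zi; rewrite !F2; try lia.
  by rewrite zi /= => /Hi; lia.
case: (ltnP 1 (h y)) => [y1|y1] H; last first.
  by apply: (unique 0) => [|u z /hL]; lia.
(* Here [c1] is not repeated: it exceeds every valuation, or it is at least [m] and the edge of
   valuation [m], from height 2^m + 1 to the top, is avoided. *)
have [C|C] := boolP ((m < c1) || (h y < M)).
  apply: (unique 1); first by lia.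
  move=> u z /hL uL' /hL zL z1; rewrite (F1 z) // => E.
  case: (ltngtP (h u) 1) => // u1.
    by have := F0 u ltac:(lia); lia.
  rewrite F2 // in E; have := @logn2_lt m.+1 (h u).-1; have := @logn2_lt m (h u).-1.
  by rewrite expnS; move: (expn_gt0 2 m) C; rewrite /M in yM *; lia.
have {C H} [mc1 hyM m0 ix] :
    [/\ c1 = m, h y = M, 0 < m & h x = 0 -> idx x != m.-1].
  move: C H; rewrite negb_or -!leqNgt => /andP[C1 C2].
  rewrite (leq_gtF C1) (leq_gtF C2) /= => /andP[m0 /implyP H].
  by split; [lia|lia|lia|move=> x0; apply: H; rewrite x0].
have E2 : 2 ^ m = 2 * 2 ^ m.-1 by rewrite -expnS; congr (2 ^ _); lia.
have D0 := expn_gt0 2 m.-1.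
(* Among 1, ..., 2^m only 2^(m-1) has valuation m - 1; height 1 carries [m], and [ix] excludes
   height 0. *)
apply: (unique (2 ^ m.-1).+1); first by rewrite hyM /M; lia.
move=> u z uL' /hL zL zj.
have -> : F z = m.-1 by rewrite F2 zj /= ?pfactorK //; lia.
case: (ltngtP (h u) 1) => u1 E.
- have u0 : h u = 0 by lia.
  have x0 : h x = 0 by have := hL u uL'; lia.
  have ux : u = x by apply: eL; rewrite ?inE ?eqxx //; lia.
  by move: E (ix x0); rewrite ux /F /ruler_color x0 /= => ->; rewrite eqxx.
- rewrite F2 // in E; have := hL u uL'; rewrite hyM /M => uM.
  have := @logn2_max m.-1 (h u).-1; rewrite E prednK // => /(_ _ erefl) <-; lia.
- by move: E; rewrite F1 //; lia.
Qed.

(** By symmetry only rising pairs and pairs of height 0 remain, since distinct vertices of equal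
    height have height 0. *)
Lemma cf_linked_all (r : rel G) (c : {set G} -> nat) (f : G -> nat) (D : {set G}) :
  symmetric r -> (forall u w, (h u).+1 == h w -> c [set u; w] = f u) ->
  {in D &, forall x y, h x < h y ->
    {in lower_part h v x y, forall u w, (h u).+1 == h w -> r u w} /\
    cf_word (map f (lower_part h v x y))} ->
  {in D &, forall x y, x != y -> h x = 0 -> h y = 0 ->
    [/\ r x (v 1), r (v 1) y & f x != f y]} ->
  {in D &, forall x y, x != y -> cf_linked r c x y}.
Proof.
move=> rs cf up pd x y xD yD xy; case: (ltngtP (h x) (h y)) => E.
- by have [H1 H2] := up x y xD yD E; apply: (cf_linked_rising B E H1 cf H2).
- have [H1 H2] := up y x yD xD E; apply: cf_linked_sym rs _.
  exact: (cf_linked_rising B E H1 cf H2).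
- have x0 : h x = 0.
    by apply/eqP; rewrite -leqn0 leqNgt; apply: contraNN xy => x0; apply/eqP; apply: h_inj.
  have y0 : h y = 0 by rewrite -E.
  by have [H1 H2 H3] := pd x y xD yD xy x0 y0; exact: (cf_linked_pendant B M0 x0 y0 xy H3 H1 H2 cf).
Qed.

Lemma broom_colorable : cf_colorable G m.+2.
Proof.
have [idx [ii il _]] := exists_indexing P (v 1); rewrite cardP in il.
have [c cf] := exists_edge_coloring h (ruler_color idx m.+1).
exists c; split=> [e|x y].
  rewrite inE => /existsP[x /existsP[y /andP[]]].
  rewrite adjE ltnS => /orP[] E /eqP->; last rewrite setUC; rewrite cf //;
    by apply: ruler_color_lt => //; have := h_le x; have := h_le y; lia.
apply: (@cf_linked_all _ c _ setT _ cf) => {x y}//; first exact: adj_sym.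
- move=> x y _ _ xy; split=> [u _ w E|]; first by rewrite adjE E.
  by apply: ruler_word; rewrite ?ltnSn.
- move=> x y _ _ xy x0 y0; rewrite !adjE x0 y0 vK // /ruler_color x0 y0 /=.
  by split=> //; apply: contraNneq xy => /ii ->//; rewrite inE ?x0 ?y0.
Qed.

Lemma cf_word2 (T : eqType) (a b : T) : cf_word [:: a; b] -> a != b.
Proof. by case=> c /=; apply: contra_eqN => /eqP->; case: (b == c). Qed.

Lemma broom_not_colorable : ~ cf_colorable G m.+1.
Proof.
case=> c [cn cc].
pose f u := c [set u; v (h u).+1].
have cf u w : (h u).+1 == h w -> c [set u; w] = f u.
  by move=> /eqP E; rewrite /f E (broom_hK B) -?E.
(* The rising path is the only one from [x] to [y], so its word must be conflict-free. *)
have low x y : h x < h y -> cf_word (map f (lower_part h v x y)).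
  move=> xy; have [|p [pp up pl [a pa]]] := cc x y.
    by apply: contraTneq xy => ->; rewrite ltnn.
  have := up_path_unique B pp up; rewrite pl => /(_ xy) E; exists a.
  rewrite -(belast_rising_path v xy) -E.
  rewrite -(colors_belast (c := c) (rise := [rel u w | (h u).+1 == h w])) //.
  by rewrite E; apply: (path_rising_path B xy) => u _ w.
pose s := map f (map v (iota 1 (2 ^ m).+1)).
have lowv i n : 0 < i -> 0 < n -> i + n <= M ->
    cf_word (map f (map v (iota i n))).
  move=> i0 n0 iM; have := low (v i) (v (i + n)).
  rewrite /lower_part !vK; try lia.
  by case: n n0 iM => // n _ iM; rewrite addKn /=; apply; lia.
have fC u : h u < M -> f u \in iota 0 m.+1.
  move=> uM; rewrite mem_iota /= add0n; apply: cn; rewrite inE.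
  apply/existsP; exists u; apply/existsP; exists (v (h u).+1).
  by rewrite adjE vK ?eqxx.
have v1 : h (v 1) = 1 by rewrite vK.
have fP x : x \in P -> f x != f (v 1).
  rewrite inE => /eqP x0; apply: cf_word2.
  by have := low x (v 2); rewrite /lower_part x0 vK //=; apply.
have fPP : {in P &, injective f}.
  move=> x y; rewrite !inE => /eqP x0 /eqP y0 fxy; apply/eqP/negPn/negP => xy.
  have [p [pp up pl [a pa]]] := cc x y xy.
  move: pa; rewrite (pendant_path_unique B x0 y0 xy pp up pl) //= => pa.
  have : cf_word [:: f x; f y].
    by exists a; move: pa; rewrite [[set v 1; y]]setUC !cf ?x0 ?y0 ?v1.
  by move/cf_word2; rewrite fxy eqxx.
(* The edge above [v 1] and the [m] pendant edges have m + 1 distinct colors, hence exhaust the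
   palette. *)
have pend i : i \in iota 0 m.+1 -> i != f (v 1) -> exists2 x, x \in P & f x = i.
  pose t := f (v 1) :: map f (enum P).
  have ut : uniq t.
    rewrite /= map_inj_in_uniq ?enum_uniq ?andbT; last first.
      by move=> x y; rewrite !mem_enum; apply: fPP.
    apply/mapP => -[x]; rewrite mem_enum => /fP.
    by move=> /eqP H E; apply: H.
  have st : {subset t <= iota 0 m.+1}.
    move=> j; rewrite inE => /orP[/eqP->|/mapP[x]]; first by apply: fC; rewrite v1.
    by rewrite mem_enum inE => /eqP x0 ->; apply: fC; rewrite x0.
  have [|_ Et] := uniq_min_size ut st.
    by rewrite size_iota /= size_map -cardE cardP.
  rewrite -Et inE => /orP[->//|/mapP[x]]; rewrite mem_enum => xP -> _.
  by exists x.
(* This word comes from the 2^m edges above heights 2, ..., 2^m + 1; the bound would give 2^m + 1 <=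
   2^m. *)
have := @cf_pendant_size _ (iota 0 m.+1) (f (v 1)) (map f (map v (iota 2 (2 ^ m)))).
rewrite !size_map !size_iota /= ltnn => H; suff: false by []; apply: H.
- by apply: fC; rewrite v1.
- move=> i /mapP[x /mapP[j]]; rewrite mem_iota => ji -> ->.
  by apply: fC; rewrite vK /M; lia.
- move=> u w t E w0.
  have E' : s = u ++ w ++ t by rewrite -E.
  have sz : size u + (size w + size t) = (2 ^ m).+1.
    by rewrite -!size_cat -E' !size_map size_iota.
  have -> : w = take (size w) (drop (size u) s).
    by rewrite E' drop_size_cat // take_size_cat.
  rewrite -!map_drop -!map_take drop_iota take_iota.
  by apply: lowv; rewrite /M; lia.
- move=> i u t iC iv E; have [x xP <-] := pend i iC iv.
  have sz : size u + size t = 2 ^ m.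
    by rewrite -size_cat -E !size_map size_iota.
  have -> : u = take (size u) (map f (map v (iota 2 (2 ^ m)))).
    by rewrite E take_size_cat.
  move: xP; rewrite inE => /eqP x0.
  rewrite -!map_take take_iota; have := low x (v (size u).+2).
  rewrite /lower_part x0 vK /M; last by lia.
  have -> : minn (size u) (2 ^ m) = size u by lia.
  by apply.
Qed.

(* If [e] goes up from a vertex of height 0, this vertex gets the color [m.-1];
   if [e] is higher up, no component contains both a vertex of height at most 1
   and the top. *)
Lemma broom_component_colorable (e : {set G}) (z : del_edge e) : e \in edges G ->
  cf_colorable (induced (component z)) m.+1.
Proof.
rewrite inE => /existsP[a0 /existsP[b0 /andP[ab0 /eqP E0]]].
have [a [b [ab Ee]]] : exists a b, (h a).+1 = h b /\ e = [set a; b].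
  move: ab0; rewrite adjE => /orP[]/eqP E; first by exists a0, b0.
  by exists b0, a0; rewrite setUC.
have {a0 b0 ab0 E0} bE w : (h a).+1 = h w -> w = b.
  by move=> E; apply: h_inj; lia.
have dE u w : del_adj e u w = adj u w && ([set u; w] != e) by [].
(* Among rising edges only the one leaving [a] is deleted. *)
have ok u w : u != a -> (h u).+1 == h w -> del_adj e u w.
  move=> ua uw; rewrite dE adjE uw /=; apply: contra_neq ua => E.
  have : u \in e by rewrite -E !inE eqxx.
  rewrite Ee !inE => /orP[/eqP//|/eqP ub].
  have : w \in e by rewrite -E !inE eqxx orbT.
  by rewrite Ee !inE => /orP[]/eqP wE; move: uw; rewrite ub wE -ab => /eqP; lia.
have nab u w : del_adj e u w -> u = a -> w != b.
  rewrite dE => /andP[_ H] ua; apply: contraNneq H => wb.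
  by rewrite ua wb Ee.
have [idx [ii il il1]] := exists_indexing P a; rewrite cardP in il il1.
have [c cf] := exists_edge_coloring h (ruler_color idx m).
apply: (@cf_colorable_component (del_edge e) z c) => [d|].
  rewrite inE => /existsP[x /existsP[y /andP[]]].
  rewrite [adj _ _]dE adjE ltnS => /andP[/orP[] E _] /eqP->; last rewrite setUC; rewrite cf //;
    by apply: ruler_color_lt => //; have := h_le x; have := h_le y; lia.
have conn x y : x \in component z -> y \in component z -> connect (del_adj e) x y.
  rewrite !inE => zx zy; apply: connect_trans zy.
  by rewrite (sym_connect_sym (@del_adj_sym _ e)).
have vU u : del_adj e u (v 1) -> del_adj e (v 1) u by rewrite del_adj_sym.
have fne x y : x != y -> h x = 0 -> h y = 0 -> ruler_color idx m x != ruler_color idx m y.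
  move=> xy x0 y0; rewrite /ruler_color x0 y0 /=.
  by apply: contraNneq xy => /ii ->//; rewrite inE ?x0 ?y0.
have v1 : h (v 1) = 1 by rewrite vK.
case: (posnP (h a)) => [a0|a0].
  have aP : a \in P by rewrite inE a0.
  have m0 : 0 < m by rewrite -cardP; apply/card_gt0P; exists a.
  (* Without its only edge the leaf [a] is isolated, so a component with two vertices avoids it. *)
  have sep x y : x \in component z -> y \in component z -> x != y -> x != a.
    move=> xz yz; apply: contra_neq => xa.
    have cl : closed (del_adj e) (pred1 a).
      apply: intro_closed; first exact: (sym_connect_sym (@del_adj_sym _ e)).
      move=> u w uw /eqP ua; have := nab u w uw ua.
      by move: uw; rewrite dE adjE ua a0 orbF => /andP[/eqP E _]; rewrite (bE w) ?eqxx ?a0.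
    by have := closed_connect cl (conn x y xz yz); rewrite !inE xa eqxx => /esym/eqP->.
  apply: (@cf_linked_all (del_adj e) c _ (component z) _ cf); first exact: del_adj_sym.
  - move=> x y xz yz xy.
    have xa : x != a.
      by apply: (sep x y) => //; apply: contraTneq xy => ->; rewrite ltnn.
    split=> [u uL w|].
      apply: ok; have := mem_lower_part B xy uL => /andP[_ /orP[/eqP->//|xu]].
      by apply: contraTneq xu => ->; rewrite a0.
    apply: ruler_word => //; rewrite m0 /=; apply/or4P/Or44/implyP => /eqP x0.
    by apply: contra_neq xa => E; apply: il1 => //; rewrite inE x0.
  - move=> x y xz yz xy x0 y0; split; last exact: fne.
      by apply: ok; rewrite ?x0 ?v1 //; apply: (sep x y).
    by apply: vU; apply: ok; rewrite ?y0 ?v1 //; apply: (sep y x); rewrite // eq_sym.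
(* The deleted edge separates the heights up to [h a] from those above. *)
have sep x y : x \in component z -> y \in component z -> (h x <= h a) = (h y <= h a).
  move=> xz yz.
  have cl : closed (del_adj e) [pred u | h u <= h a].
    apply: intro_closed; first exact: (sym_connect_sym (@del_adj_sym _ e)).
    move=> u w uw; rewrite !inE => ua; have := nab u w uw.
    move: uw; rewrite dE adjE => /andP[/orP[]/eqP E _]; last by lia.
    case: (ltngtP (h u) (h a)) ua => [lt|//|Ea] _ H; first by lia.
    have u0 : 0 < h u by lia.
    by have := H (h_inj u0 Ea); rewrite (bE w) ?eqxx //; lia.
  by have := closed_connect cl (conn x y xz yz); rewrite !inE.
apply: (@cf_linked_all (del_adj e) c _ (component z) _ cf); first exact: del_adj_sym.
- move=> x y xz yz xy; have := sep x y xz yz => sxy.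
  split=> [u uL w|].
    apply: ok; have := mem_lower_part B xy uL => /andP[ux _].
    by apply: contraTneq ux => ->; lia.
  (* Either both ends lie above [a], so that [1 < h x], or both lie at most at [h a], so that
     [h y < M]. *)
  by apply: ruler_word => //; have := h_le b; move: sxy; lia.
- have na x : h x = 0 -> x != a by move=> x0; apply: contraTneq a0 => <-; rewrite x0.
  move=> x y xz yz xy x0 y0; split; last exact: fne.
    by apply: ok; rewrite ?x0 ?v1 ?na.
  by apply: vU; apply: ok; rewrite ?y0 ?v1 ?na.
Qed.

Lemma broom_critical : k_cfc_critical m.+2 G.
Proof.
have E : cfc G = m.+2 by apply: cfc_eq broom_colorable broom_not_colorable.
have v12 : v 1 != v 2.
  by apply/eqP => /(congr1 h); rewrite !vK // /M; have := expn_gt0 2 m; lia.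
split=> //; split.
- split; last exact: (broom_acyclic B).
    by apply/card_gt0P; exists (v 1).
  by have [c [_ /cf_connected_connected]] := broom_colorable.
- rewrite /nontrivial (cardD1 (v 1)) (cardD1 (v 2)) !inE eq_sym v12; lia.
- move=> e eG S /imsetP[z _ ->] _; rewrite E ltnS.
  exact/cfc_leq/broom_component_colorable.
Qed.

End BroomCritical.

(** * The tree as a broom *)

(** At an inner vertex, both [p.+1] and [p.-1] would be the single neighbor. *)
Lemma leaf_path_graph N (p : path_graph N) : leaf p -> p = 0 :> nat \/ p.+1 = N.
Proof.
move=> /cards1P[q E]; have pN := ltn_ord p.
have nb (j : nat) (jN : j < N) : (p.+1 == j) || (j.+1 == p) -> j = q.
  move=> H; suff /set1P<- : Ordinal jN \in [set q] by [].
  by rewrite -E inE.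
case: (posnP p) => [|p0]; [by left|right]; apply/eqP; rewrite eqn_leq pN /=.
rewrite leqNgt; apply/negP => p1.
have := nb p.+1 p1; rewrite eqxx => /(_ isT).
by have := nb p.-1 ltac:(lia); rewrite prednK // eqxx orbT => /(_ isT); lia.
Qed.

Section IdentifyStarPath.
Variables (m n N : nat) (l : star n) (p : path_graph N).
Hypotheses (En : n = m.+1) (EN : N = 2 ^ m + 1).
Hypotheses (hl : leaf l) (hp : leaf p).

(* The distance of [val y] to [p] is a sum of truncated subtractions. *)
Definition star_path_height (a : identify l p) : nat :=
  match a with
  | inl s => if s == l then 2 else adj l s
  | inr y => 2 + (val y - p) + (p - val y)
  end.

Local Notation h := star_path_height.

Let valp (y : {y : path_graph N | y != p}) : (val y : nat) <> p.
Proof. by move=> E; case/eqP: (valP y); apply: val_inj. Qed.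

Lemma star_path_adj x y : adj x y = ((h x).+1 == h y) || ((h y).+1 == h x).
Proof.
case: x y => [s|y] [s'|y'] /=.
- rewrite /star_adj /=; case: (eqVneq s l) => [->|sl]; case: (eqVneq s' l) => [->|sl'].
  + by rewrite addbb.
  + by case: (_ (+) _).
  + by rewrite addbC; case: (_ (+) _).
  + move: sl sl'; case: (eqVneq l ord0) => [->|_].
      by move=> /negPf-> /negPf->.
    by case: (s == ord0); case: (s' == ord0).
- have := @valp y'; have := leaf_path_graph hp; have := ltn_ord (val y').
  case: eqP => _; first by rewrite /path_adj /=; lia.
  by case: (star_adj l s) => /=; lia.
- have := @valp y; have := leaf_path_graph hp; have := ltn_ord (val y).
  case: eqP => _; first by rewrite /path_adj /=; lia.
  by case: (star_adj l s') => /=; lia.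
- have := @valp y; have := @valp y'; have := leaf_path_graph hp.
  have := ltn_ord (val y); have := ltn_ord (val y').
  by rewrite /path_adj /=; lia.
Qed.

Lemma star_path_inj x y : 0 < h x -> h x = h y -> x = y.
Proof.
(* The unique neighbor [c] of [l] serves as the center; this also covers K_{1,1}, where [l] may be
   [ord0]. *)
have [c Ec] := cards1P hl.
have Ac s : star_adj l s = (s == c) by have := in_set1 s c; rewrite -Ec inE.
case: x y => [s|y] [s'|y'] /=; rewrite ?Ac.
- case: (eqVneq s l) => [->|_]; case: (eqVneq s' l) => [->|_] //.
  + by case: (s' == c).
  + by case: (s == c).
  + by case: eqP => [->|//] _; case: eqP => [->|].
- have := @valp y'; case: eqP => _ /= yp _ E; exfalso; move: E; first by lia.
  by case: eqP => _ /=; lia.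
- have := @valp y; case: eqP => _ /= yp _ E; exfalso; move: E; first by lia.
  by case: eqP => _ /=; lia.
- move=> _ E; congr inr; apply: val_inj; apply: val_inj.
  have := leaf_path_graph hp; have := ltn_ord (val y); have := ltn_ord (val y').
  by move: E => /=; lia.
Qed.

Lemma star_path_le x : h x <= (2 ^ m).+2.
Proof.
case: x => [s|y] /=; first by case: (s == l) => //; case: (star_adj l s).
by move: (ltn_ord (val y)) (ltn_ord p) => /=; lia.
Qed.

Lemma star_path_height_ex j : 0 < j <= (2 ^ m).+2 -> exists x, h x = j.
Proof.
case: j => [//|[_|[_|d]]].
- have [c Ec] := cards1P hl; exists (inl c).
  have lc : star_adj l c by have := set11 c; rewrite -Ec inE.
  by rewrite /= lc; case: eqP lc => // ->; rewrite star_adj_irrefl.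
- by exists (inl l); rewrite /= eqxx.
- move=> dm; have pN := ltn_ord p.
  have [q qN qd] : exists2 q, q < N & (q - p) + (p - q) = d.+1.
    by case: (leaf_path_graph hp) => pE; [exists d.+1|exists (p - d.+1)]; lia.
  have qp : Ordinal qN != p by rewrite -val_eqE /=; apply/eqP => E; lia.
  by exists (inr (exist _ (Ordinal qN) qp)); rewrite /= -addnA qd.
Qed.

(** Of the m + 2 vertices of the star, only [l] and its single neighbor have positive height. *)
Lemma star_path_pendants : #|[set x | h x == 0]| = m.
Proof.
have -> : [set x | h x == 0] = inl @: ~: (l |: [set y | adj l y]).
  apply/setP => -[s|y]; rewrite inE; last first.
    by apply/esym/imsetP => -[].
  rewrite mem_imset; last by move=> ? ? [].
  by rewrite !inE negb_or /=; case: (s == l) => //=; case: (star_adj l s).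
rewrite card_imset; last by move=> ? ? [].
rewrite cardsCs setCK cardsU1 inE adj_irrefl (eqP hl) card_ord En.
by rewrite /= subSS subn1.
Qed.

Lemma identify_star_path_critical : k_cfc_critical m.+2 (identify l p).
Proof.
have /choice[v vK] : forall j, exists x, 0 < j <= (2 ^ m).+2 -> h x = j.
  move=> j; case: (boolP (0 < j <= (2 ^ m).+2)) => [/star_path_height_ex[x <-]|].
    by exists x.
  (* Outside the range of heights any vertex will do as a default. *)
  by exists (inl l).
apply: (@broom_critical _ _ h v _ star_path_pendants); split.
- exact: star_path_adj.
- exact: star_path_inj.
- exact: star_path_le.
- exact: vK.
Qed.

End IdentifyStarPath.

Theorem theorem4p5 (k : nat) (hk : 2 <= k)
    (l : star (k - 1)) (p : path_graph (2 ^ (k - 2) + 1))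
    (hl : leaf l) (hp : leaf p) :
  k_cfc_critical k (identify l p).
Proof.
have Ek : k = (k - 2).+2 by lia.
rewrite [X in k_cfc_critical X _]Ek.
by apply: identify_star_path_critical => //; lia.
Qed.
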